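(* Let $\varrho\in(0,1)$, and suppose that the penalty function $\mathrm{pen}:\Theta\to\mathbb R$ and the constant $\mathfrak Q(\varrho)$ are such that $$\mathbf E\exp\Bigl\{\varrho\bigl[\mathcal L(\tilde\theta,\theta_0)+\mathfrak M(\tilde\theta,\theta_0)-\mathrm{pen}(\tilde\theta)\bigr]\Bigr\}\le\mathfrak Q(\varrho).$$ Let $\mathcal E(\mathfrak z)=\{\theta\in\Theta:\mathcal L(\tilde\theta,\theta)\le\mathfrak z\}$ and $\mathfrak b=\sup_{\theta\in\Theta}[\mathrm{pen}(\theta)-\mathfrak M(\theta,\theta_0)]_+$. Then for any $\mathfrak z>0$ $$\mathbf P\bigl(\theta_0\notin\mathcal E(\mathfrak z)\bigr)\le\mathfrak Q(\varrho)\exp\{-\varrho\mathfrak z+\varrho\mathfrak b\}.$$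
   Context: $\Theta\subseteq\mathbb R^p$, and $(\mathcal L(\theta))_{\theta\in\Theta}$ is a real-valued random process on a probability space with measure $\mathbf P$ and expectation $\mathbf E$ (e.g. a scaled quasi log-likelihood). $\theta_0=\arg\max_{\theta\in\Theta}\mathbf E\mathcal L(\theta)$, $\tilde\theta=\arg\max_{\theta\in\Theta}\mathcal L(\theta)$, $\mathcal L(\theta,\theta')=\mathcal L(\theta)-\mathcal L(\theta')$. The rate function $\mathfrak M(\theta,\theta_0)=-\log\mathbf E\exp\{\mathcal L(\theta,\theta_0)\}$ is assumed finite for all $\theta\in\Theta$. $[x]_+=\max\{x,0\}$. *)

(* Defs.v *)
From mathcomp Require Import all_boot all_order all_algebra.
From mathcomp Require Import all_classical all_reals all_analysis.

Set Implicit Arguments.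
Unset Strict Implicit.
Unset Printing Implicit Defensive.

Import Order.TTheory GRing.Theory Num.Theory.
Import numFieldNormedType.Exports.

Local Open Scope classical_set_scope.
Local Open Scope ring_scope.

(* A maximizer need not be unique. *)
Definition is_argmax (dV : Order.disp_t) (V : porderType dV) (U : Type)
    (A : set U) (f : U -> V) (x : U) : Prop :=
  A x /\ forall y, A y -> (f y <= f x)%O.

(* Processes, penalties and rates are total functions on R^p (row vectors);
   only their values on the parameter set Theta are ever used. *)

Definition lik_ratio (R : realType) (p : nat) (T : Type)
    (L : 'rV[R]_p -> T -> R) (theta theta' : 'rV[R]_p) (w : T) : R :=
  L theta w - L theta' w.

(* Extended-real valued: it is -oo when the exponential moment is infinite. *)
Definition rate (R : realType) (p : nat) (d : measure_display)
    (T : measurableType d) (P : probability T R) (L : 'rV[R]_p -> T -> R)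
    (theta theta0 : 'rV[R]_p) : \bar R :=
  (- lne ('E_P[fun w => expR (lik_ratio L theta theta0 w)]))%E.

(* L(that, theta0) + M(that, theta0) - pen(that); [fine] is harmless where the
   rate is finite. *)
Definition penalized_excess (R : realType) (p : nat) (d : measure_display)
    (T : measurableType d) (P : probability T R) (L : 'rV[R]_p -> T -> R)
    (pen : 'rV[R]_p -> R) (theta0 : 'rV[R]_p) (that : T -> 'rV[R]_p)
    (w : T) : R :=
  lik_ratio L (that w) theta0 w + fine (rate P L (that w) theta0)
  - pen (that w).

Definition conf_set (R : realType) (p : nat) (T : Type)
    (Theta : set 'rV[R]_p) (L : 'rV[R]_p -> T -> R) (that : T -> 'rV[R]_p)
    (z : R) (w : T) : set 'rV[R]_p :=
  [set theta | Theta theta /\ lik_ratio L (that w) theta w <= z].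

(* The supremum is taken in the extended reals, so it may be +oo. *)
Definition penalty_bias (R : realType) (p : nat) (d : measure_display)
    (T : measurableType d) (P : probability T R) (Theta : set 'rV[R]_p)
    (L : 'rV[R]_p -> T -> R) (pen : 'rV[R]_p -> R)
    (theta0 : 'rV[R]_p) : \bar R :=
  ereal_sup
    [set (Num.max (pen theta - fine (rate P L theta theta0)) 0)%:E
      | theta in Theta].

(* Main.v *)
(* If theta0 is outside the confidence set, L(that, theta0) > z; since that lies
   in Theta, M(that, theta0) - pen(that) >= - b, so the penalized excess is at
   least z - b, and the exponential Markov inequality concludes. *)

Require Import Defs.
From mathcomp Require Import all_boot all_order all_algebra.
From mathcomp Require Import all_classical all_reals all_analysis.
From mathcomp Require Import measurable_realfun.

Set Implicit Arguments.
Unset Strict Implicit.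
Unset Printing Implicit Defensive.

Import Order.TTheory GRing.Theory Num.Theory.
Import numFieldNormedType.Exports.

Local Open Scope classical_set_scope.
Local Open Scope ring_scope.

(** A nonnegative function with zero integral vanishes almost everywhere; as [f] vanishes nowhere,
    the exceptional null set would be the whole space, which has mass 1. *)
Lemma probability_integral_gt0 (R : realType) (d : measure_display)
    (T : measurableType d) (P : probability T R) (f : T -> \bar R) :
  measurable_fun setT f -> (forall x, 0 < f x)%E ->
  (0 < \int[P]_x f x)%E.
Proof.
move=> mf f0; rewrite lt0e integral_ge0 ?andbT; last by move=> x _; exact: ltW.
apply/eqP => If0.
have : (\int[P]_x `|f x|)%E = 0%E.
  by rewrite -{}If0; apply: eq_integral => x _; rewrite gee0_abs// ltW.
move/(ae_eq_integral_abs P measurableT mf) => [A [mA PA0 subA]].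
have AT : A = setT.
  apply/seteqP; split => // x _; apply: subA => /= /(_ I) fx0.
  by have := f0 x; rewrite fx0 ltxx.
have := probability_setT P; rewrite -AT (PA0 : P A = 0%E) => /esym/eqP.
by rewrite onee_eq0.
Qed.

(** Markov's inequality for [expR (X w)] at level [expR a], whose level set contains [A] by
    monotonicity of the exponential. *)
Lemma exponential_markov (R : realType) (d : measure_display)
    (T : measurableType d) (P : probability T R) (A : set T) (X : T -> R)
    (a Q : R) :
  measurable A -> measurable_fun setT X -> (forall w, A w -> a <= X w) ->
  ('E_P[fun w => expR (X w)] <= Q%:E)%E ->
  (P A <= (Q * expR (- a))%:E)%E.
Proof.
move=> mA mX AX EQ.
have mY : measurable_fun setT (fun w => (expR (X w))%:E).
  by apply/measurable_EFinP; exact: measurableT_comp.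
have mk := le_integral_abse P measurableT mY (expR_gt0 a).
rewrite setTI in mk.
have PA : (P A <= P [set w | (expR a)%:E <= `|(expR (X w))%:E|]%E)%E.
  apply: le_measure; rewrite ?inE//.
    rewrite -[X in measurable X]setTI.
    apply: emeasurable_fun_c_infty => //; exact: measurableT_comp.
  by move=> w Aw /=; rewrite lee_fin ger0_norm ?expR_ge0// ler_expR AX.
rewrite EFinM muleC expRN lee_pdivlMl ?expR_gt0//.
apply: le_trans EQ; rewrite unlock.
(* The absolute value is inserted to match the integrand of [mk]. *)
under eq_integral do rewrite -[X in X%:E]ger0_norm ?expR_ge0//.
apply: le_trans mk; rewrite lee_pmul2l// ?lte_fin ?expR_gt0//.
Qed.

(* The two measurability hypotheses on [that] say that the quantities whose
   probability and expectation are taken are random variables. *)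
Theorem corollary2p6 (R : realType) (p : nat) (d : measure_display)
    (T : measurableType d) (P : probability T R)
    (Theta : set 'rV[R]_p) (L : 'rV[R]_p -> T -> R)
    (theta0 : 'rV[R]_p) (that : T -> 'rV[R]_p)
    (pen : 'rV[R]_p -> R) (rho Q : R)
    (L_meas : forall theta, Theta theta -> measurable_fun setT (L theta))
    (theta0_argmax : is_argmax Theta (fun theta => ('E_P[L theta])%E) theta0)
    (that_argmax :
      forall w, is_argmax Theta (fun theta => L theta w) (that w))
    (Lmax_meas : measurable_fun setT (fun w => L (that w) w))
    (excess_meas : measurable_fun setT (penalized_excess P L pen theta0 that))
    (rate_fin :
      forall theta, Theta theta -> rate P L theta theta0 \is a fin_num)
    (rho_gt0 : 0 < rho) (rho_lt1 : rho < 1)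
    (exp_bound :
      ('E_P[fun w => expR (rho * penalized_excess P L pen theta0 that w)%R]
        <= Q%:E)%E) :
  forall z : R, 0 < z ->
    (P [set w | ~ conf_set Theta L that z w theta0]
      <= Q%:E * expeR (- (rho * z)%:E
                       + rho%:E * penalty_bias P Theta L pen theta0))%E.
Proof.
move=> z z0.
have Th0 : Theta theta0 by case: theta0_argmax.
have Tht w : Theta (that w) by case: (that_argmax w).
set b := penalty_bias _ _ _ _ _.
have le_b theta : Theta theta ->
    ((Num.max (pen theta - fine (rate P L theta theta0)) 0)%:E <= b)%E.
  by move=> ?; apply: ereal_sup_ubound; exists theta.
(* The supremum runs over a nonempty set, as [theta0] lies in [Theta]; this rules out -oo in the
   case analysis on [b]. *)
have b0 : (0 <= b)%E.
  by apply: le_trans (le_b _ Th0); rewrite lee_fin le_max lexx orbT.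
have mrhoX : measurable_fun setT
    (fun w => rho * penalized_excess P L pen theta0 that w).
  exact: measurable_funM.
have Q0 : 0 < Q.
  rewrite -lte_fin; apply: lt_le_trans exp_bound; rewrite unlock.
  apply: probability_integral_gt0 => [|w]; last by rewrite lte_fin expR_gt0.
  by apply/measurable_EFinP; exact: measurableT_comp.
(* When the bias is +oo the bound is Q * +oo, which is +oo only because 0 < Q
   (0 * +oo = 0 in the extended reals). *)
case: b b0 le_b => [b| |]// _ le_b; last first.
  by rewrite gt0_muley ?lte_fin// addey// [expeR _]/= gt0_muley ?lte_fin// leey.
(* Since [theta0] lies in [Theta], non-coverage can only come from the likelihood inequality. *)
have eventE : [set w | ~ conf_set Theta L that z w theta0] =
    [set w | z < lik_ratio L (that w) theta0 w].
  apply/seteqP; split => w /=; rewrite /conf_set /=.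
    by move=> nc; rewrite ltNge; apply/negP => le_z; apply: nc.
  by move=> lt_z [_]; rewrite leNgt lt_z.
rewrite {}eventE [X in expeR X](_ : _ = (- (rho * z) + rho * b)%:E)//= -EFinM.
(* This exposes the Markov level [rho * (z - b)] for [rho] times the penalized excess. *)
have -> : - (rho * z) + rho * b = - (rho * (z - b)).
  by rewrite mulrBr opprB addrC.
apply: exponential_markov exp_bound => //.
  rewrite -[X in measurable X]setTI.
  have -> : [set w | z < lik_ratio L (that w) theta0 w] =
      (fun w => lik_ratio L (that w) theta0 w) @^-1` `]z, +oo[%classic.
    by apply/seteqP; split => w /=; rewrite in_itv/= andbT.
  by apply: measurable_funB => //; exact: L_meas.
move=> w /= lt_z; rewrite ler_pM2l// /penalized_excess -addrA.
rewrite lerD ?(ltW lt_z)//.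
(* The bound by [b] is uniform over [Theta], so it may be used at the random point [that w]; the
   positive part dominates its argument. *)
have := le_b _ (Tht w); rewrite lee_fin ge_max => /andP[le_pen _].
by rewrite -opprB lerN2.
Qed.
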